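(* Let $G$ be a graph on the vertex set $V$ and let $S,S^*$ be subsets of $V$ with $S$ non-empty. Suppose that $W^S$ has rank $\geq|V|-1$. Then there is an automorphism $g$ of $G$ with $S^g=S^*$ (i.e. $\{g(v):v\in S\}=S^*$) if and only if ${\rm lex}(W^S)={\rm lex}(W^{S^*})$.
   Context: Graphs are finite, simple, undirected. For a graph $G$ on $V=\{v_1,\dots,v_n\}$ with adjacency matrix $A$ and $S\subseteq V$ with characteristic vector ${\rm e}\in\{0,1\}^n$, the walk matrix is $W^S=[{\rm e},A{\rm e},\dots,A^{n-1}{\rm e}]$. For a matrix $W$, ${\rm lex}(W)$ is the matrix obtained by permuting the rows of $W$ into lexicographical order. *)

(* Defs.v *)
From HB Require Import structures.
From mathcomp Require Import all_boot all_order all_fingroup all_algebra.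
Set Implicit Arguments. Unset Strict Implicit. Unset Printing Implicit Defensive.
Import Order.TTheory GRing.Theory Num.Theory.
Local Open Scope ring_scope.

Definition simple_graph (T : finType) (e : rel T) : Prop :=
  symmetric e /\ irreflexive e.

Definition graph_aut (T : finType) (e : rel T) (g : {perm T}) : Prop :=
  forall x y, e (g x) (g y) = e x y.

Definition adjmx (n : nat) (e : rel 'I_n) : 'M[rat]_n :=
  \matrix_(i, j) (e i j)%:R.

Definition charvec (n : nat) (S : {set 'I_n}) : 'cV[rat]_n :=
  \col_i (i \in S)%:R.

(* Entries are natural numbers; they are taken in rat so that \rank is the
   usual rank in characteristic 0. *)
Definition walkmx (n : nat) (e : rel 'I_n) (S : {set 'I_n}) : 'M[rat]_n :=
  \matrix_(i, k) (adjmx e ^+ k *m charvec S) i 0.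

(* All rows have the same length, so seqlexi is the lexicographic order on
   them, the leftmost entry being the most significant. *)
Definition row_seqs (m n : nat) (W : 'M[rat]_(m, n)) : seq (seqlexi rat) :=
  [seq [seq W i j | j : 'I_n] | i : 'I_m].

Definition lexmx (m n : nat) (W : 'M[rat]_(m, n)) : 'M[rat]_(m, n) :=
  \matrix_(i, j) (nth [::] (sort <=%O (row_seqs W)) i)`_j.

(* Main.v *)
(** Suppose the walk matrices of [S] and [S'] agree up to a permutation [p] of
    the rows.  Relabelling by [p] turns them into the walk matrices of two
    graphs with adjacency matrices A and B, and into an equality, so the
    difference D = A - B kills A^k e for all k <= n - 2.  By the Krylov property,
    rank >= n - 1 makes these n - 1 vectors independent, hence rank D <= 1;
    being symmetric with zero diagonal, D vanishes, so [p] is an automorphism. *)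

Require Import Defs.
From HB Require Import structures.
From mathcomp Require Import all_boot all_order all_fingroup all_algebra.
Set Implicit Arguments. Unset Strict Implicit. Unset Printing Implicit Defensive.
Import Order.TTheory GRing.Theory Num.Theory.
Local Open Scope ring_scope.

(** Vectors are rows, to match the row-space order [<=%MS]; the length [m] is free, so that
    truncations can be compared. *)
Definition krylovmx (F : fieldType) (n : nat) (A : 'M[F]_n) (u : 'rV[F]_n)
  (m : nat) : 'M[F]_(m, n) := \matrix_(i < m) (u *m A ^+ i).

Lemma mulmx_exprSr (F : fieldType) n (A : 'M[F]_n) (u : 'rV[F]_n) k :
  u *m A ^+ k.+1 = u *m A ^+ k *m A.
Proof. by rewrite exprSr -mulmxA. Qed.

Lemma krylov_sub (F : fieldType) n (A : 'M[F]_n) (u : 'rV[F]_n) k m :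
  (k < m)%N -> (u *m A ^+ k <= krylovmx A u m)%MS.
Proof.
move=> km; have := row_sub (Ordinal km) (krylovmx A u m).
by rewrite rowK.
Qed.

(** The span of the first [k] rows is stable under [A]: each row is sent to the next one, and the
    last to [u *m A ^+ k], which lies in the span by hypothesis. *)
Lemma krylov_saturated (F : fieldType) n (A : 'M[F]_n) (u : 'rV[F]_n) k m :
  (u *m A ^+ k <= krylovmx A u k)%MS -> (krylovmx A u m <= krylovmx A u k)%MS.
Proof.
move=> uk.
have stab : (krylovmx A u k *m A <= krylovmx A u k)%MS.
  apply/row_subP => i; rewrite row_mul rowK -mulmx_exprSr.
  have [ik|ki] := ltnP i.+1 k; first exact: krylov_sub.
  by have -> : i.+1 = k by apply/eqP; rewrite eqn_leq ltn_ord.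
apply/row_subP => i; rewrite rowK; elim: (nat_of_ord i) => [|j IHj].
  (* For [k = 0] the goal is [uk] itself; otherwise [u] is the first row. *)
  by case: k uk {stab} => // k _; apply: krylov_sub.
by rewrite mulmx_exprSr (submx_trans (submxMr A IHj)).
Qed.

(** A new row either leaves the span of the previous ones, raising the rank, or lies in it, and then
    the span never grows again. *)
Lemma krylov_free_or_saturated (F : fieldType) n (A : 'M[F]_n) (u : 'rV[F]_n) m :
  (m <= \rank (krylovmx A u m))%N \/
  exists2 k, (k < m)%N & forall p, (krylovmx A u p <= krylovmx A u k)%MS.
Proof.
elim: m => [|m [IHm|[k km sat]]]; first by left.
  case: (boolP (u *m A ^+ m <= krylovmx A u m)%MS) => um.
    by right; exists m => // p; apply: krylov_saturated.
  left; apply: leq_ltn_trans IHm _; apply: rank_ltmx; rewrite /ltmx.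
  apply/andP; split.
    apply/row_subP => i; rewrite rowK krylov_sub //.
    exact: ltnW (ltn_ord i).
  by apply: contra um; apply: submx_trans; apply: krylov_sub.
by right; exists k => //; apply: ltnW.
Qed.

(** Saturation at some [k < m] would bound every rank by [k]. *)
Lemma rank_krylov_pred (F : fieldType) n (A : 'M[F]_n) (u : 'rV[F]_n) m p :
  (m <= \rank (krylovmx A u p))%N -> (m <= \rank (krylovmx A u m))%N.
Proof.
move=> mp; have [//|[k km sat]] := krylov_free_or_saturated A u m.
have := leq_trans mp (leq_trans (mxrankS (sat p)) (rank_leq_row _)).
by rewrite leqNgt km.
Qed.

(** If [D i j] were nonzero, row [i] would span the row space; row [j] would be a multiple of it, so
    [D j i] a multiple of [D i i = 0], against symmetry. *)
Lemma sym_hollow_rank1_eq0 (F : fieldType) n (D : 'M[F]_n) :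
  D^T = D -> (forall i, D i i = 0) -> (\rank D <= 1)%N -> D = 0.
Proof.
move=> symD diagD rkD; apply/matrixP => i j; rewrite mxE.
apply/eqP; apply/negPn/negP => Dij.
have rowi0 : row i D != 0.
  by apply: contra Dij => /eqP/rowP/(_ j); rewrite !mxE => ->.
have eq_rowi : (D <= row i D)%MS.
  have := mxrank_leqif_sup (row_sub i D).
  case=> le_rk <-; rewrite eqn_leq le_rk rank_rV rowi0.
  exact: rkD.
have /sub_rVP[a /rowP/(_ i)] := submx_trans (row_sub j D) eq_rowi.
rewrite !mxE diagD mulr0 => Dji.
by move: Dij; rewrite -symD mxE Dji eqxx.
Qed.

Lemma krylov_sym_hollow_inj (F : fieldType) n (A B : 'M[F]_n) (u : 'rV[F]_n) :
  A^T = A -> B^T = B -> (forall i, A i i = B i i) ->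
  krylovmx A u n = krylovmx B u n ->
  (n - 1 <= \rank (krylovmx A u n))%N -> A = B.
Proof.
move=> symA symB diagAB eqK rkK; apply/eqP; rewrite -subr_eq0; apply/eqP.
apply: sym_hollow_rank1_eq0 => [|i|].
- by rewrite linearB /= symA symB.
- by rewrite !mxE diagAB subrr.
have eqpow k : (k < n)%N -> u *m A ^+ k = u *m B ^+ k.
  by move=> kn; have /row_matrixP/(_ (Ordinal kn)) := eqK; rewrite !rowK.
(* Only [n - 1] rows: killing row [k] uses the equality of the powers [k] and [k.+1], known below
   [n]. *)
have KD0 : krylovmx A u (n - 1) *m (A - B) = 0.
  apply/row_matrixP => k; rewrite row_mul rowK row0 mulmxBr -mulmx_exprSr.
  have kn : (k.+1 < n)%N by have := ltn_ord k; rewrite ltn_subRL add1n.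
  by rewrite !eqpow ?(ltnW kn) // -mulmx_exprSr subrr.
(* Matrices with product 0 have ranks adding up to at most [n], and the left factor has rank at
   least [n - 1]. *)
rewrite -(leq_add2l (n - 1)); apply: (@leq_trans n); last first.
  by rewrite addnC -leq_subLR.
by apply: leq_trans (mulmx0_rank_max KD0); rewrite leq_add2r (rank_krylov_pred rkK).
Qed.

Lemma adjmx_sym n (e : rel 'I_n) : symmetric e -> (adjmx e)^T = adjmx e.
Proof. by move=> es; apply/matrixP => i j; rewrite !mxE es. Qed.

Lemma trmx_expr (F : fieldType) n (A : 'M[F]_n) k : (A ^+ k)^T = A^T ^+ k.
Proof.
by elim: k => [|k IHk]; [exact: trmx1 | rewrite exprS exprSr trmx_mul IHk].
Qed.

Lemma walkmx_krylov n (e : rel 'I_n) (S : {set 'I_n}) : symmetric e ->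
  walkmx e S = (krylovmx (adjmx e) (charvec S)^T n)^T.
Proof.
move=> es; apply/matrixP => i k; rewrite [LHS]mxE 2![RHS]mxE.
by rewrite -{2}(adjmx_sym es) -trmx_expr -trmx_mul [RHS]mxE.
Qed.

Lemma charvec_inj n : injective (@charvec n).
Proof.
move=> S S' /colP eqS; apply/setP => i; have := eqS i.
by rewrite !mxE => /eqP; rewrite eqr_nat; do 2 case: (i \in _).
Qed.

Lemma walkmx_inj n (e e' : rel 'I_n) (S S' : {set 'I_n}) :
  simple_graph e -> simple_graph e' -> (n - 1 <= \rank (walkmx e S))%N ->
  walkmx e S = walkmx e' S' -> e =2 e' /\ S = S'.
Proof.
move=> [es ei] [es' ei'] rkW eqW.
(* Column 0 of a walk matrix is the characteristic vector; an index [i] guarantees that this column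
   exists. *)
have eqS : S = S'.
  apply: charvec_inj; apply/colP => i.
  have n_gt0 : (0 < n)%N by apply: leq_ltn_trans (ltn_ord i).
  by have /matrixP/(_ i (Ordinal n_gt0)) := eqW; rewrite [LHS]mxE [RHS]mxE !expr0 !mul1mx.
split=> //; rewrite -eqS {S' eqS} in eqW.
rewrite (walkmx_krylov _ es) mxrank_tr in rkW.
rewrite !walkmx_krylov // in eqW.
have /matrixP eqA : adjmx e = adjmx e'.
  apply: krylov_sym_hollow_inj rkW; rewrite ?adjmx_sym //.
  - by move=> i; rewrite !mxE ei ei'.
  - exact: trmx_inj eqW.
move=> i j; have /eqP := eqA i j.
by rewrite !mxE eqr_nat; case: (e i j); case: (e' i j).
Qed.

(** Relabelling the vertices conjugates the adjacency matrix, which amounts to reindexing the sum in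
    each product by [p]. *)
Lemma row_perm_walkmx n (e : rel 'I_n) (S : {set 'I_n}) (p : {perm 'I_n}) :
  row_perm p (walkmx e S) = walkmx (relpre p e) (p @^-1: S).
Proof.
apply/matrixP => i k; rewrite 2![LHS]mxE [RHS]mxE; move: (nat_of_ord k) => {}k.
elim: k i => [|k IHk] i.
  by rewrite !expr0 !mul1mx !mxE inE.
rewrite !exprS -!mulmxA !mxE (reindex_inj (@perm_inj _ p)) /=.
by apply: eq_bigr => j _; rewrite IHk !mxE.
Qed.

(** The tuple form lets [tuple_permP] turn [perm_eq] into a permutation of the row indices. *)
Lemma row_seqs_tuple m n (W : 'M[rat]_(m, n)) :
  row_seqs W = [tuple [seq W i j | j : 'I_n] : seqlexi rat | i < m].
Proof. by []. Qed.

Lemma row_seq_inj m m' n (W : 'M[rat]_(m, n)) (W' : 'M[rat]_(m', n)) i i' :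
  [seq W i j | j : 'I_n] = [seq W' i' j | j : 'I_n] -> W i =1 W' i'.
Proof. by move/eq_in_map => eqW j; apply: eqW; rewrite mem_enum. Qed.

Lemma perm_row_seqsP m n (W W' : 'M[rat]_(m, n)) :
  perm_eq (row_seqs W) (row_seqs W') <-> exists p, W = row_perm p W'.
Proof.
rewrite (row_seqs_tuple W'); split=> [/tuple_permP[p eqW]|[p ->]].
  exists p; apply/matrixP => i j; rewrite mxE; apply: row_seq_inj.
  rewrite row_seqs_tuple in eqW; have /(congr1 (fun t => tnth t i)) := val_inj eqW.
  by rewrite !tnth_mktuple.
apply/tuple_permP; exists p; rewrite row_seqs_tuple; congr val.
apply: eq_mktuple => i; rewrite tnth_mktuple.
by apply: eq_map => j; rewrite mxE.
Qed.

Lemma size_sort_row_seqs m n (W : 'M[rat]_(m, n)) :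
  size (sort <=%O (row_seqs W)) = m.
Proof. by rewrite size_sort row_seqs_tuple size_tuple. Qed.

Lemma size_nth_sort_row_seqs m n (W : 'M[rat]_(m, n)) i : (i < m)%N ->
  size (nth [::] (sort <=%O (row_seqs W)) i) = n.
Proof.
move=> im; have := mem_nth [::] (_ : i < size (sort <=%O (row_seqs W)))%N.
rewrite size_sort_row_seqs mem_sort => /(_ im) /mapP[k _ ->].
by rewrite size_map size_enum_ord.
Qed.

Lemma lexmx_eqP m n (W W' : 'M[rat]_(m, n)) :
  lexmx W = lexmx W' <-> exists p, W = row_perm p W'.
Proof.
split=> [/matrixP eqW | /perm_row_seqsP/perm_sort_leP eqW]; last first.
  by rewrite /lexmx eqW.
(* [lexmx] reads the sorted list through [nth] with defaults, so the list is recovered from its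
   entries once the sizes [m] and [n] are known. *)
apply/perm_row_seqsP/perm_sort_leP; apply: (@eq_from_nth _ [::]).
  by rewrite !size_sort_row_seqs.
move=> i; rewrite size_sort_row_seqs => im.
apply: (@eq_from_nth _ 0); rewrite !size_nth_sort_row_seqs // => j jn.
by have := eqW (Ordinal im) (Ordinal jn); rewrite !mxE.
Qed.

Theorem theorem6p4 (n : nat) (e : rel 'I_n) (S S' : {set 'I_n})
    (e_simple : simple_graph e) (S_neq0 : S != set0)
    (rankW : (n - 1 <= \rank (walkmx e S))%N) :
  (exists g : {perm 'I_n}, graph_aut e g /\ [set g v | v in S] = S') <->
  lexmx (walkmx e S) = lexmx (walkmx e S').
Proof.
split=> [[g [aut_g <-]]|/lexmx_eqP[p]].
  apply/lexmx_eqP; exists g; rewrite row_perm_walkmx.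
  have -> : g @^-1: (g @: S) = S.
    by apply/setP => i; rewrite inE mem_imset //; apply: perm_inj.
  suff eqA : adjmx (relpre g e) = adjmx e by rewrite /walkmx eqA.
  by apply/matrixP => i j; rewrite !mxE /= aut_g.
(* [eqW] now compares two simple graphs on the same vertices, so [e] is [relpre p e] and [S] is the
   preimage of [S']: the witness is [p] itself. *)
rewrite row_perm_walkmx => eqW; have [es ei] := e_simple.
have simple_p : simple_graph (relpre p e).
  by split=> [x y|x] /=; [rewrite es | rewrite ei].
have [eqe ->] := walkmx_inj e_simple simple_p rankW eqW.
exists p; split=> [x y|]; first by rewrite (eqe x y).
apply/setP => i; rewrite -{1}(permKV p i) mem_imset ?inE ?permKV //.
exact: perm_inj.
Qed.
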